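(* Let $m\ge n\ge1$ and $K\ge0$, and let $G_0,\dots,G_K\in\mathbb{R}^{m\times n}$ be matrices of full column rank with orthogonal polar factors $U_0,\dots,U_K$. For each $k$ run the dynamically weighted Halley (DWH) iteration, equivalent to the QDWH algorithm, $$\widetilde U_{k,0}=\frac{G_k}{\|G_k\|_S},\qquad\widetilde U_{k,j+1}=\widetilde U_{k,j}\bigl(a_jI_n+b_j\widetilde U_{k,j}^\top\widetilde U_{k,j}\bigr)\bigl(I_n+c_j\widetilde U_{k,j}^\top\widetilde U_{k,j}\bigr)^{-1}$$ with the QDWH dynamic weighting parameters $(a_j,b_j,c_j)$ (defined in the context) for $T$ inner steps and set $\widetilde U_k=\widetilde U_{k,T}$. Here $\ell_0=\min_{0\le k\le K}\sigma_{\min}(\widetilde U_{k,0})\in(0,1]$ is the smallest singular-value lower bound over all iterations. Let $\varepsilon_{\max}(T)=\max_{0\le k\le K}\|\widetilde U_k-U_k\|_S$ and $\delta_{\max}(T)=\max_{0\le k\le K}\|\widetilde U_k^\top\widetilde U_k-I_n\|_S$. (1) There are constants $C_\varepsilon,C_\delta>0$, independent of $k$ and $T$, with $$\varepsilon_{\max}(T)\le C_\varepsilon(1-\ell_0^2)^{3^T}\quad\text{and}\quad\delta_{\max}(T)\le C_\delta(1-\ell_0^2)^{3^T}.$$ (2) Let $f\colon\mathbb{R}^{m\times n}\to\mathbb{R}\cup\{+\infty\}$ be $L$-Lipschitz smooth and $\mu$-Polyak–Łojasiewicz, $L,\mu\in(0,\infty)$, with $f^\star=\min f$ and $\kappa_H=L/\mu$.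 For every $\ell_0\in(0,1)$ there are constants $C>0$ and $\eta_0\in(0,1)$ such that for every $\eta\in(0,\eta_0]$ and every integer $$T\ge\Bigl\lceil C\log\Bigl(\frac{\log\eta}{\log(1-\ell_0^2)}\Bigr)\Bigr\rceil$$ the following holds: if realized PolarGrad $X_{k+1}=X_k-\gamma\langle\widetilde U_k,G_k\rangle_F\widetilde U_k$ is run with $G_k=\nabla f(X_k)$ (of full column rank for $0\le k\le K$), with $\widetilde U_k=\widetilde U_{k,T}$ obtained from $T$ steps of the DWH iteration $\widetilde U_{k,0}=G_k/\|G_k\|_S$, $\widetilde U_{k,j+1}=\widetilde U_{k,j}(a_jI_n+b_j\widetilde U_{k,j}^\top\widetilde U_{k,j})(I_n+c_j\widetilde U_{k,j}^\top\widetilde U_{k,j})^{-1}$ with the QDWH dynamic weighting parameters $(a_j,b_j,c_j)$ started from $\ell_0$, with $\gamma=1/(Lr_{\max}(1+\delta_{\max}(T)))$, $r_{\max}=\max_{0\le k\le K}\mathrm{rank}(G_k)$, and if $\min_{0\le k\le K}\sigma_{\min}(\widetilde U_{k,0})$ along the run equals $\ell_0$, then its rate is within a factor $1-\eta$ of the exact rate $1/(r_{\max}\kappa_H)$, i.e. for $0\le k\le K$ $$f(X_{k+1})-f^\star\le\Bigl(1-\frac{1-\eta}{r_{\max}\kappa_H}\Bigr)\bigl(f(X_k)-f^\star\bigr).$$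
   Context: $\|\cdot\|_F$ is the Frobenius norm, $\|\cdot\|_S$ the spectral norm, $\langle A,B\rangle_F=\mathrm{tr}(A^\top B)$, and $\sigma_{\min}$ the smallest singular value. The orthogonal polar factor of $G$ with compact singular value decomposition $\sum_{i=1}^r\sigma_iu_iv_i^\top$ ($\sigma_i>0$) is $U=\sum_{i=1}^ru_iv_i^\top$. QDWH weighting parameters: starting from $\ell_0$, for $j\ge0$, $$a_j=h(\ell_j),\quad b_j=\frac{(a_j-1)^2}{4},\quad c_j=a_j+b_j-1,\quad\ell_{j+1}=\frac{\ell_j(a_j+b_j\ell_j^2)}{1+c_j\ell_j^2},$$ where $$h(\ell)=\sqrt{1+\theta}+\frac12\sqrt{8-4\theta+\frac{8(2-\ell^2)}{\ell^2\sqrt{1+\theta}}},\qquad\theta=\theta(\ell)=\Bigl(\frac{4(1-\ell^2)}{\ell^4}\Bigr)^{1/3}.$$ $f$ is $L$-Lipschitz smooth if it is finite and differentiable everywhere and $\|\nabla f(X)-\nabla f(Y)\|_F\le L\|X-Y\|_F$ for all $X,Y$. $f$ is $\mu$-Polyak–Łojasiewicz if $\|\nabla f(X)\|_F^2\ge2\mu(f(X)-f^\star)$ for all $X$, where $f^\star=\min f$ (assumed attained). *)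

(* Defs.v *)
From HB Require Import structures.
From mathcomp Require Import all_boot all_order all_algebra.
From mathcomp Require Import all_classical all_reals all_analysis.

Set Implicit Arguments.
Unset Strict Implicit.
Unset Printing Implicit Defensive.

Import Order.TTheory GRing.Theory Num.Theory.
Import numFieldNormedType.Exports.

Local Open Scope classical_set_scope.
Local Open Scope ring_scope.

Section MatrixNotions.
Context {R : realType}.

Definition frob_inner m n (A B : 'M[R]_(m, n)) : R := \tr (A^T *m B).

Definition frob_norm m n (A : 'M[R]_(m, n)) : R := Num.sqrt (frob_inner A A).

(* For m x n matrices with n <= m; for m < n the kernel of A would contribute
   a spurious 0, which would affect [sigma_min]. *)
Definition singular_value m n (A : 'M[R]_(m, n)) (s : R) : Prop :=
  0 <= s /\ eigenvalue (A^T *m A) (s ^+ 2).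

(* For 1 <= n <= m the set of singular values is finite and nonempty, so that
   [sup] and [inf] are the largest and the smallest singular value. *)
Definition spectral_norm m n (A : 'M[R]_(m, n)) : R :=
  sup [set s | singular_value A s].

Definition sigma_min m n (A : 'M[R]_(m, n)) : R :=
  inf [set s | singular_value A s].

Definition compact_svd m n r (A : 'M[R]_(m, n))
    (u : 'M[R]_(m, r)) (s : 'rV[R]_r) (v : 'M[R]_(n, r)) : Prop :=
  [/\ u^T *m u = 1%:M, v^T *m v = 1%:M, (forall i, 0 < s 0 i) &
      A = u *m diag_mx s *m v^T].

Definition polar_factor m n (A U : 'M[R]_(m, n)) : Prop :=
  exists r (u : 'M[R]_(m, r)) (s : 'rV[R]_r) (v : 'M[R]_(n, r)),
    compact_svd A u s v /\ U = u *m v^T.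

End MatrixNotions.

Section Maxima.
Context {R : realType}.

(* Maximum and minimum of x 0, ..., x K. *)
Definition max_upto (K : nat) (x : nat -> R) : R :=
  \big[Num.max/x 0%N]_(k < K.+1) x k.

Definition min_upto (K : nat) (x : nat -> R) : R :=
  \big[Num.min/x 0%N]_(k < K.+1) x k.

End Maxima.

Section QDWH.
Context {R : realType}.

Definition qdwh_theta (l : R) : R :=
  (4 * (1 - l ^+ 2) / l ^+ 4) `^ (3^-1).

Definition qdwh_h (l : R) : R :=
  let t := qdwh_theta l in
  Num.sqrt (1 + t) +
  2^-1 * Num.sqrt (8 - 4 * t + 8 * (2 - l ^+ 2) / (l ^+ 2 * Num.sqrt (1 + t))).

Definition qdwh_a (l : R) : R := qdwh_h l.
Definition qdwh_b (l : R) : R := (qdwh_a l - 1) ^+ 2 / 4.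
Definition qdwh_c (l : R) : R := qdwh_a l + qdwh_b l - 1.

Fixpoint qdwh_ell (l0 : R) (j : nat) : R :=
  if j is i.+1 then
    let l := qdwh_ell l0 i in
    l * (qdwh_a l + qdwh_b l * l ^+ 2) / (1 + qdwh_c l * l ^+ 2)
  else l0.

Definition dwh_step m n (a b c : R) (V : 'M[R]_(m, n)) : 'M[R]_(m, n) :=
  V *m (a%:M + b *: (V^T *m V)) *m invmx (1%:M + c *: (V^T *m V)).

Definition dwh_init m n (G : 'M[R]_(m, n)) : 'M[R]_(m, n) :=
  (spectral_norm G)^-1 *: G.

Fixpoint dwh m n (l0 : R) (G : 'M[R]_(m, n)) (j : nat) : 'M[R]_(m, n) :=
  if j is i.+1 then
    let l := qdwh_ell l0 i in
    dwh_step (qdwh_a l) (qdwh_b l) (qdwh_c l) (dwh l0 G i)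
  else dwh_init G.

Definition ell_min m n (K : nat) (G : nat -> 'M[R]_(m, n)) : R :=
  min_upto K (fun k => sigma_min (dwh_init (G k))).

Definition eps_max m n (K : nat) (l0 : R) (G U : nat -> 'M[R]_(m, n))
    (T : nat) : R :=
  max_upto K (fun k => spectral_norm (dwh l0 (G k) T - U k)).

Definition delta_max m n (K : nat) (l0 : R) (G : nat -> 'M[R]_(m, n))
    (T : nat) : R :=
  max_upto K (fun k =>
    spectral_norm ((dwh l0 (G k) T)^T *m dwh l0 (G k) T - 1%:M)).

End QDWH.

Section Optimization.
Context {R : realType} {m n : nat}.
Implicit Types (f : 'M[R]_(m, n) -> \bar R).

(* The matrix of partial derivatives, for f finite near X. The library's norm
   on matrices is the sup norm; it is equivalent to the Frobenius norm, hence
   yields the same notion of differentiability. *)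
Definition gradient f (X : 'M[R]_(m, n)) : 'M[R]_(m, n) :=
  \matrix_(i, j) 'd (fine \o f) X (delta_mx i j).

Definition lipschitz_smooth f (L : R) : Prop :=
  [/\ forall X, f X \is a fin_num,
      forall X, differentiable (fine \o f) X &
      forall X Y, frob_norm (gradient f X - gradient f Y)
                  <= L * frob_norm (X - Y)].

Definition is_minimum f (fstar : R) : Prop :=
  (exists X, f X = fstar%:E) /\ (forall X, (fstar%:E <= f X)%E).

Definition polyak_lojasiewicz f (fstar mu : R) : Prop :=
  forall X, ((2 * mu)%:E * (f X - fstar%:E)
             <= (frob_norm (gradient f X) ^+ 2)%:E)%E.

End Optimization.

(* Main.v *)
(* In a singular value decomposition G = u diag(s) v^T the DWH iteration acts
   on the singular values alone, through x -> x (a + b x^2) / (1 + c x^2). For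
   the QDWH weights this map g satisfies, with p = 2 / (a - 1),
     1 - g(x) = (1 - x) (1 - x / p)^2 / (1 + c x^2),
     g(x) - g(l) = b (x - l) (x - l / p)^2 / (1 + c x^2),
   so that it maps [l, 1] into [g(l), 1]. The second identity amounts to
   p^3 (p + 2) = l^2 (1 + 2 p), which is the quartic equation solved by h(l).
   As g is odd, the first one gives
     1 - g(l)^2 = (1 - l^2) (1 - (l / p)^2)^2 / (1 + c l^2)^2 <= (1 - l^2)^3,
   hence 1 - y^2 <= E := (1 - l0^2)^(3^T) for every singular value y after T
   steps, and both constants of part (1) can be taken to be 1.
   For part (2), the descent lemma with the given step size yields
   f(X') <= f(X) - gamma <V, G>^2 / 2, and <V, G> is the sum of the y_i s_i, so
   <V, G>^2 >= (1 - E) |G|_F^2. With the PL inequality the rate is at least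
   (1 - E) / (1 + delta) times the exact one, and delta <= E <= eta / 2. *)
Require Import Defs.
From HB Require Import structures.
From mathcomp Require Import all_boot all_order all_algebra.
From mathcomp Require Import all_classical all_reals all_analysis.
From mathcomp Require Import ring lra complex.

Set Implicit Arguments.
Unset Strict Implicit.
Unset Printing Implicit Defensive.

Import Order.TTheory GRing.Theory Num.Theory.
Import numFieldNormedType.Exports.

Local Open Scope classical_set_scope.
Local Open Scope ring_scope.

(** * The QDWH map on singular values *)

Section QdwhScalar.
Context {R : realType}.
Implicit Types l x a : R.

Lemma qdwh_theta_cube l : 0 < l <= 1 ->
  qdwh_theta l ^+ 3 = 4 * (1 - l ^+ 2) / l ^+ 4.
Proof.
move=> /andP[l0 l1]; rewrite /qdwh_theta -powR_mulrn ?powR_ge0// -powRrM.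
rewrite mulVf ?pnatr_eq0// powRr1// divr_ge0 ?exprn_ge0 ?(ltW l0)//.
by rewrite mulr_ge0// subr_ge0 expr_le1// ltW.
Qed.

(* Ferrari's resolution of the quartic: with [s = sqrt (1 + theta)] and
   [P = (2 / l^2 - 1) / s], it factors as
   [(a^2 - 2 s a + 2 s^2 - 3 - 2 P) (a^2 + 2 s a + 2 s^2 - 3 + 2 P)],
   and [qdwh_h l] is the larger root of the first factor. *)
Lemma qdwh_a_quartic l : 0 < l <= 1 ->
  16 * qdwh_a l = l ^+ 2 * (qdwh_a l + 3) * (qdwh_a l - 1) ^+ 3.
Proof.
move=> hl; have /andP[l0 l1] := hl.
have l2 : 0 < l ^+ 2 by rewrite exprn_gt0.
have l21 : l ^+ 2 <= 1 by rewrite expr_le1// ltW.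
have t3 := qdwh_theta_cube hl.
rewrite /qdwh_a /qdwh_h.
have : 0 <= qdwh_theta l by rewrite powR_ge0.
move: (qdwh_theta l) t3 => t t3 t0.
have s1 : 1 <= Num.sqrt (1 + t) by rewrite -[leLHS]sqrtr1 ler_wsqrtr// lerDl.
have s2 : Num.sqrt (1 + t) ^+ 2 = 1 + t by rewrite sqr_sqrtr// addr_ge0.
move: (Num.sqrt (1 + t)) s1 s2 => s s1 s2.
have s0 : 0 < s by lra.
set P := (2 / l ^+ 2 - 1) / s.
have P0 : 0 <= P.
  rewrite /P divr_ge0 ?(ltW s0)// subr_ge0 ler_pdivlMr//; lra.
have sP : l ^+ 2 * (s * P + 1) = 2.
  by rewrite /P; field; rewrite !gt_eqF//.
(* By the choice of theta, [(2 / l^2 - 1)^2 = 1 + t^3], so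
   [P^2 = (1 + t^3) / (1 + t) = t^2 - t + 1]. *)
have P2 : P ^+ 2 = s ^+ 4 - 3 * s ^+ 2 + 3.
  have -> : s ^+ 4 - 3 * s ^+ 2 + 3 = (t ^+ 3 + 1) / s ^+ 2.
    have -> : t = s ^+ 2 - 1 by rewrite s2; ring.
    by field; rewrite gt_eqF.
  by rewrite t3 /P; field; rewrite !gt_eqF.
have -> : 8 - 4 * t + 8 * (2 - l ^+ 2) / (l ^+ 2 * s) =
    2 ^+ 2 * (3 - s ^+ 2 + 2 * P).
  by rewrite s2 /P; field; rewrite !gt_eqF.
(* The second radicand must be nonnegative for its root to square back; this follows from
   [4 P^2 - (s^2 - 3)^2 = 3 (s^2 - 1)^2]. *)
have w0 : 0 <= 3 - s ^+ 2 + 2 * P.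
  have : (s ^+ 2 - 3) ^+ 2 <= (2 * P) ^+ 2.
    rewrite exprMn P2 -subr_ge0.
    have -> : 2 ^+ 2 * (s ^+ 4 - 3 * s ^+ 2 + 3) - (s ^+ 2 - 3) ^+ 2 =
      3 * (s ^+ 2 - 1) ^+ 2 by ring.
    by rewrite mulr_ge0// sqr_ge0.
  case: (lerP (s ^+ 2 - 3) 0) => [|h]; first by lra.
  rewrite ler_sqr ?nnegrE ?(ltW h)//; first by lra.
  by lra.
rewrite sqrtrM ?sqr_ge0// sqrtr_sqr ger0_norm// mulKf//.
move: (sqr_sqrtr w0); move: (Num.sqrt _) => w w2.
have hF : (s + w) ^+ 2 - 2 * s * (s + w) + 2 * s ^+ 2 - 3 - 2 * P = 0.
  by transitivity (w ^+ 2 - (3 - s ^+ 2 + 2 * P)); [ring|rewrite w2 subrr].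
set a := s + w in hF *.
have hq : (a + 3) * (a - 1) ^+ 3 = 8 * (s * P + 1) * a.
  apply/eqP; rewrite -subr_eq0; apply/eqP.
  transitivity ((a ^+ 2 - 2 * s * a + 2 * s ^+ 2 - 3 - 2 * P) *
    (a ^+ 2 + 2 * s * a + 2 * s ^+ 2 - 3 + 2 * P) +
    4 * (P ^+ 2 - (s ^+ 4 - 3 * s ^+ 2 + 3))); first by ring.
  by rewrite hF P2; ring.
rewrite -mulrA hq.
have -> : l ^+ 2 * (8 * (s * P + 1) * a) = (l ^+ 2 * (s * P + 1)) * (8 * a).
  by ring.
by rewrite sP; ring.
Qed.

(** If [1 <= a < 3], then [l^2 (a + 3) (a - 1)^3 <= 4 (a + 3) (a - 1) < 16 a], the last step being
    [(a - 3) (a + 1) < 0]; this contradicts the quartic. *)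
Lemma qdwh_a_ge3 l : 0 < l <= 1 -> 3 <= qdwh_a l.
Proof.
move=> hl; have /andP[l0 l1] := hl.
have l21 : l ^+ 2 <= 1 by rewrite expr_le1// ltW.
have l20 : 0 < l ^+ 2 by rewrite exprn_gt0.
have a1 : 1 <= qdwh_a l.
  rewrite /qdwh_a /qdwh_h /= -[leLHS]addr0 lerD//.
  by rewrite -[leLHS]sqrtr1 ler_wsqrtr// lerDl powR_ge0.
have := qdwh_a_quartic hl; move: (qdwh_a l) a1 => a a1 hq.
rewrite leNgt; apply/negP => a3.
have : (a + 3) * (a - 1) ^+ 3 <= (a + 3) * (4 * (a - 1)).
  rewrite ler_wpM2l//; first by lra.
  rewrite exprS mulrC ler_wpM2r//; [lra|nra].
have : l ^+ 2 * ((a + 3) * (a - 1) ^+ 3) <= (a + 3) * (a - 1) ^+ 3.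
  rewrite ler_piMl// mulr_ge0//; first by lra.
  by rewrite exprn_ge0//; lra.
move: hq; rewrite -mulrA => <-.
nra.
Qed.

(* [qdwh_p l] is the interior point of [[l, 1]] where the weighted Halley map
   attains its maximum 1; by the symmetry x -> l / x its interior minimum is
   at [l / qdwh_p l]. *)
Definition qdwh_p l : R := 2 / (qdwh_a l - 1).

Lemma qdwh_p_quartic l : 0 < l <= 1 ->
  qdwh_p l ^+ 3 * (qdwh_p l + 2) = l ^+ 2 * (1 + 2 * qdwh_p l).
Proof.
move=> hl; have := qdwh_a_quartic hl; have := qdwh_a_ge3 hl.
rewrite /qdwh_p; move: (qdwh_a l) => a a3 hq.
have a1 : a - 1 != 0 by rewrite gt_eqF//; lra.
transitivity (16 * a / (a - 1) ^+ 4); first by field.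
by rewrite hq; field.
Qed.

(** The upper bound is [3 <= a]. If [p < l], then [p^3 (p + 2) < l^2 p (p + 2) <= l^2 (1 + 2 p)]
    because [p <= 1], against the quartic in [p]. *)
Lemma qdwh_p_bounds l : 0 < l <= 1 -> l <= qdwh_p l <= 1.
Proof.
move=> hl; have a3 := qdwh_a_ge3 hl; have hp := qdwh_p_quartic hl.
have p0 : 0 < qdwh_p l by rewrite divr_gt0//; lra.
have p1 : qdwh_p l <= 1 by rewrite ler_pdivrMr; lra.
rewrite p1 andbT leNgt; apply/negP => pl.
move: (qdwh_p l) hp p0 p1 pl => p hp p0 p1 pl.
have : p ^+ 2 < l ^+ 2 by rewrite ltr_sqr ?nnegrE; lra.
have /andP[l0 l1] := hl.
have e : p ^+ 3 * (p + 2) = p ^+ 2 * (p * (p + 2)) by ring.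
rewrite e in hp; move=> p2l2.
have Q0 : 0 < p * (p + 2) by rewrite mulr_gt0//; lra.
have : p ^+ 2 * (p * (p + 2)) < l ^+ 2 * (p * (p + 2)) by rewrite ltr_pM2r.
have : l ^+ 2 * (p * (p + 2)) <= l ^+ 2 * (1 + 2 * p).
  by rewrite ler_wpM2l ?sqr_ge0//; nra.
lra.
Qed.

Lemma qdwh_b_p l : 0 < l <= 1 -> qdwh_b l = 1 / qdwh_p l ^+ 2.
Proof.
move=> hl; have a3 := qdwh_a_ge3 hl; rewrite /qdwh_b /qdwh_p.
by field; rewrite gt_eqF//; lra.
Qed.

Lemma qdwh_a_p l : 0 < l <= 1 -> qdwh_a l = (qdwh_p l + 2) / qdwh_p l.
Proof.
move=> hl; have a3 := qdwh_a_ge3 hl; rewrite /qdwh_p.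
by field; rewrite gt_eqF//; lra.
Qed.

Lemma qdwh_c_p l : 0 < l <= 1 ->
  qdwh_c l = (1 + 2 * qdwh_p l) / qdwh_p l ^+ 2.
Proof.
move=> hl; have a3 := qdwh_a_ge3 hl; rewrite /qdwh_c /qdwh_b /qdwh_p.
by field; rewrite gt_eqF//; lra.
Qed.

Definition qdwh_map l x : R :=
  x * (qdwh_a l + qdwh_b l * x ^+ 2) / (1 + qdwh_c l * x ^+ 2).

Lemma qdwh_c_gt0 l : 0 < l <= 1 -> 0 < qdwh_c l.
Proof.
move=> hl; have a3 := qdwh_a_ge3 hl; rewrite /qdwh_c.
have : 0 <= qdwh_b l by rewrite divr_ge0 ?sqr_ge0.
lra.
Qed.

Lemma qdwh_den_gt0 l x : 0 < l <= 1 -> 0 < 1 + qdwh_c l * x ^+ 2.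
Proof.
move=> hl; rewrite ltr_pwDl// mulr_ge0 ?sqr_ge0//.
exact/ltW/qdwh_c_gt0.
Qed.

Lemma qdwh_map_le1 l x : 0 < l <= 1 -> x <= 1 -> qdwh_map l x <= 1.
Proof.
move=> hl x1; rewrite -subr_ge0.
have d0 := qdwh_den_gt0 x hl.
have -> : 1 - qdwh_map l x =
  (1 - x) * (1 - (qdwh_a l - 1) / 2 * x) ^+ 2 / (1 + qdwh_c l * x ^+ 2).
  rewrite /qdwh_map; move: (d0); rewrite /qdwh_c /qdwh_b => d0'.
  by field; lra.
by rewrite mulr_ge0 ?invr_ge0 ?(ltW d0)// mulr_ge0 ?sqr_ge0// subr_ge0.
Qed.

Lemma qdwh_map_ge l x : 0 < l <= 1 -> l <= x -> qdwh_map l l <= qdwh_map l x.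
Proof.
move=> hl lx; rewrite -subr_ge0.
have dx := qdwh_den_gt0 x hl; have dl := qdwh_den_gt0 l hl.
have hp := qdwh_p_quartic hl; have /andP[lp p1] := qdwh_p_bounds hl.
have /andP[l0 l1] := hl.
suff -> : qdwh_map l x - qdwh_map l l = qdwh_b l * (x - l) *
    (x - l / qdwh_p l) ^+ 2 / (1 + qdwh_c l * x ^+ 2).
  rewrite mulr_ge0 ?invr_ge0 ?(ltW dx)// mulr_ge0 ?sqr_ge0//.
  by rewrite mulr_ge0 ?subr_ge0// divr_ge0 ?sqr_ge0.
move: dx dl; rewrite /qdwh_map qdwh_c_p// qdwh_a_p// qdwh_b_p//.
move: (qdwh_p l) hp lp p1 => p hp lp p1 dx dl.
have p0 : 0 < p by lra.
have eden y : 1 + (1 + 2 * p) / p ^+ 2 * y ^+ 2 =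
   (p ^+ 2 + (1 + 2 * p) * y ^+ 2) / p ^+ 2 by field; lra.
have ex y : 0 < p ^+ 2 + (1 + 2 * p) * y ^+ 2.
  by rewrite ltr_pwDl ?exprn_gt0// mulr_ge0 ?sqr_ge0//; lra.
(* The quartic gives [c l^2 = p (p + 2)], so the denominator at [l] is [(1 + p)^2], which cancels
   against the numerator. *)
have -> : l * ((p + 2) / p + 1 / p ^+ 2 * l ^+ 2) /
  (1 + (1 + 2 * p) / p ^+ 2 * l ^+ 2) = l ^+ 3 / p ^+ 4.
  have -> : (1 + 2 * p) / p ^+ 2 * l ^+ 2 = p * (p + 2).
    by rewrite mulrAC [X in X / _]mulrC -hp; field; lra.
  have dn : 0 < 1 + p * (p + 2) by nra.
  apply/eqP; rewrite eqr_div ?expf_neq0 ?lt0r_neq0//.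
  have -> : l * ((p + 2) / p + 1 / p ^+ 2 * l ^+ 2) * p ^+ 4 =
    l * (p ^+ 3 * (p + 2) + p ^+ 2 * l ^+ 2) by field; lra.
  rewrite hp.
  by apply/eqP; ring.
have ex' := ex x.
rewrite eden.
apply/eqP; rewrite -subr_eq0; apply/eqP.
(* The defect of the claimed identity is a multiple of the defect of the quartic. *)
transitivity ((p ^+ 3 * (p + 2) - l ^+ 2 * (1 + 2 * p)) *
  (x / p ^+ 2 + l * x ^+ 2 / p ^+ 4) / (p ^+ 2 + (1 + 2 * p) * x ^+ 2)).
  by field; rewrite !gt_eqF.
by rewrite hp subrr !mul0r.
Qed.

(** As [l / p] lies in [[l, 1]], the quotient [(1 - (l / p)^2) / (1 + c l^2)] is at most [1 - l^2];
    its square supplies two of the three factors. *)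
Lemma qdwh_map_contraction l : 0 < l <= 1 ->
  1 - qdwh_map l l ^+ 2 <= (1 - l ^+ 2) ^+ 3.
Proof.
move=> hl; have /andP[l0 l1] := hl.
have d0 := qdwh_den_gt0 l hl; have /andP[lp p1] := qdwh_p_bounds hl.
have p0 : 0 < qdwh_p l by lra.
have -> : 1 - qdwh_map l l ^+ 2 = (1 - l ^+ 2) *
    ((1 - (l / qdwh_p l) ^+ 2) / (1 + qdwh_c l * l ^+ 2)) ^+ 2.
  have e3 := qdwh_a_ge3 hl.
  rewrite /qdwh_map; move: (d0); rewrite /qdwh_p /qdwh_c /qdwh_b => d0'.
  by field; lra.
have l21 : 0 <= 1 - l ^+ 2 by rewrite subr_ge0 expr_le1// ltW.
rewrite [leRHS]exprS ler_wpM2l//.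
have y1 : l / qdwh_p l <= 1 by rewrite ler_pdivrMr// mul1r.
have y0 : l <= l / qdwh_p l by rewrite ler_pdivlMr// ler_piMr// ltW.
rewrite ler_sqr ?nnegrE//; last first.
  by rewrite divr_ge0 ?(ltW d0)// subr_ge0 expr_le1//; lra.
rewrite ler_pdivrMr//.
have : l ^+ 2 <= (l / qdwh_p l) ^+ 2 by rewrite ler_sqr ?nnegrE; lra.
have : 0 <= (1 - l ^+ 2) * (qdwh_c l * l ^+ 2).
  by rewrite mulr_ge0// mulr_ge0 ?sqr_ge0// ltW// qdwh_c_gt0.
nra.
Qed.

Lemma qdwh_ell_bounds l0 j : 0 < l0 <= 1 -> 0 < qdwh_ell l0 j <= 1.
Proof.
move=> hl0; elim: j => //= j hl; have /andP[l0' l1] := hl.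
(* The recursion for [qdwh_ell] is the weighted map evaluated at its own parameter. *)
rewrite -/(qdwh_map (qdwh_ell l0 j) (qdwh_ell l0 j)) qdwh_map_le1// andbT.
rewrite divr_gt0 ?qdwh_den_gt0// mulr_gt0// ltr_pwDl//.
  by have := qdwh_a_ge3 hl; lra.
by rewrite mulr_ge0 ?sqr_ge0// divr_ge0 ?sqr_ge0.
Qed.

Lemma qdwh_ell_cvg l0 T : 0 < l0 <= 1 ->
  1 - qdwh_ell l0 T ^+ 2 <= (1 - l0 ^+ 2) ^+ (3 ^ T)%N.
Proof.
move=> hl0; elim: T => [|j IH]; first by rewrite expr1.
have hl := qdwh_ell_bounds j hl0; have /andP[lp l1] := hl.
apply: (le_trans (qdwh_map_contraction hl)).
have h0 : 0 <= 1 - qdwh_ell l0 j ^+ 2 by rewrite subr_ge0 expr_le1// ltW.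
by rewrite expnS mulnC exprM lerXn2r// nnegrE// (le_trans h0).
Qed.

(** Orbit of one singular value under the DWH steps. The weights follow [l0], not the starting value
    [x]. *)
Fixpoint qdwh_sv l0 x (j : nat) : R :=
  if j is i.+1 then qdwh_map (qdwh_ell l0 i) (qdwh_sv l0 x i) else x.

(** The bound [qdwh_ell l0 j] is the orbit of [l0] itself, and each step sends [[l, 1]] above the
    image of [l]. *)
Lemma qdwh_sv_bounds l0 x j : 0 < l0 <= 1 -> l0 <= x <= 1 ->
  qdwh_ell l0 j <= qdwh_sv l0 x j <= 1.
Proof.
move=> hl0 hx; elim: j => //= j /andP[h1 h2].
have hl := qdwh_ell_bounds j hl0; rewrite qdwh_map_le1// andbT.
exact: (qdwh_map_ge hl h1).
Qed.
End QdwhScalar.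

(** * Diagonalization of real symmetric matrices *)

Section Spectral.
Context {R : rcfType}.

(** Over [R[i]] the matrix is Hermitian, hence unitarily diagonalizable with real eigenvalues. Such
    an eigenvalue is a root of the characteristic polynomial already over [R], which yields a real
    eigenvector. *)
Lemma symmetric_eigenvector n (A : 'M[R]_n.+1) : A^T = A ->
  exists a, exists2 w : 'rV_n.+1, w *m A = a *: w & w != 0.
Proof.
move=> symA; pose toC := real_complex R.
pose B := map_mx toC A.
have realB : B \is a mxOver Num.real.
  by apply/mxOverP => i j; rewrite mxE complex_real.
have symB : B \is symmetricmx.
  apply/is_hermitianmxP; rewrite expr0 scale1r; apply/matrixP => i j.
  by rewrite !mxE -[in LHS]symA mxE.
have hermB := realsym_hermsym symB realB.
have /mxOverP/(_ 0 0)/complex_realP [a ea] :=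
  hermitian_spectral_diag_real hermB.
have /orthomx_spectralP eB := hermitian_normalmx hermB.
exists a; apply/eigenvalueP; rewrite eigenvalue_root_char.
rewrite -(fmorph_root toC) map_char_poly -eigenvalue_root_char -/B.
apply/eigenvalueP; exists (row 0 (spectralmx B)).
  have /(congr1 (mulmx (spectralmx B))) := eB.
  rewrite !mulmxA mulmxV ?spectral_unit// mul1mx => /(congr1 (row 0)).
  by rewrite !row_mul row_diag_mx ea -scalemxAl -rowE.
(* A row of a unitary matrix has norm 1, so it cannot vanish. *)
apply/eqP => r0; have /eqP := @oner_neq0 R[i]; apply.
have /unitarymxP/matrixP/(_ 0 0) := spectral_unitarymx B.
rewrite mxE (eq_bigr (fun=> 0)) ?big1// => [|j _]; first by rewrite mxE eqxx.
by move/rowP/(_ j): r0; rewrite !mxE => ->; rewrite mul0r.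
Qed.

(** For [w != e] the reflection along [z = w - e] exchanges the two unit vectors [e] and [w]. *)
Lemma unit_row_householder n (w : 'rV[R]_n.+1) : w *m w^T = 1%:M ->
  exists H : 'M[R]_n.+1, H^T *m H = 1%:M /\ delta_mx 0 0 *m H = w.
Proof.
move=> w1; pose e : 'rV[R]_n.+1 := delta_mx 0 0.
have [->|we] := eqVneq w e; first by exists 1%:M; rewrite trmx1 !mulmx1.
pose z := w - e; pose c := (z *m z^T) 0 0.
have sc (x : 'M[R]_1) : x = (x 0 0)%:M by rewrite [LHS]mx11_scalar.
have zz : z *m z^T = c%:M by rewrite [LHS]sc.
have c0 : c != 0.
  apply: contra_neq we => c0; apply/eqP; rewrite -subr_eq0; apply/eqP/rowP => i.
  have : \sum_j z 0 j ^+ 2 = 0.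
    rewrite -[RHS]c0 /c mxE; apply: eq_bigr => j _.
    by rewrite expr2; congr (_ * _); rewrite [RHS]mxE.
  move/eqP; rewrite psumr_eq0 => [/allP/(_ i)|j _]; last exact: sqr_ge0.
  by rewrite mem_index_enum sqrf_eq0 [RHS]mxE => /(_ isT)/eqP.
have ee : e *m e^T = 1%:M.
  rewrite /e trmx_delta mul_delta_mx; apply/matrixP => i j.
  by rewrite !ord1 !mxE eqxx.
have ew : w *m e^T = e *m w^T.
  by rewrite [LHS]sc [RHS]sc -[w *m _]trmxK trmx_mul trmxK [in LHS]mxE.
(* Since [e] and [w] have equal norm, [|z|^2 = 2 - 2 <e, w> = - 2 <e, z>]. *)
have ez : c%:M = - 2 *: (e *m z^T).
  rewrite -zz /z linearB/= !mulmxBr !mulmxBl w1 ee ew.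
  by move: (e *m _) 1%:M => Y I; apply/matrixP => i j; rewrite !mxE; ring.
exists (1%:M - (2 / c) *: (z^T *m z)); split.
  have -> : (1%:M - (2 / c) *: (z^T *m z))^T = 1%:M - (2 / c) *: (z^T *m z).
    by rewrite [LHS]raddfB /= trmx1 linearZ /= trmx_mul trmxK.
  rewrite mulmxBr !mulmxBl !mul1mx !mulmx1 -scalemxAl -scalemxAr.
  rewrite -mulmxA (mulmxA z) zz mul_scalar_mx -scalemxAr !scalerA.
  rewrite opprB -[RHS]addr0 -addrA; congr (_ + _).
  rewrite -scaleNr -!scalerDl -[RHS](scale0r (z^T *m z)); congr (_ *: _).
  by field.
rewrite mulmxBr mulmx1 -scalemxAr mulmxA.
have -> : e *m z^T = (- c / 2)%:M.
  apply: (@scalerI _ _ (- 2)); first by rewrite oppr_eq0 pnatr_eq0.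
  by rewrite -ez scale_scalar_mx; congr (_%:M); field.
rewrite mul_scalar_mx scalerA (_ : 2 / c * (- c / 2) = -1); last by field.
by rewrite scaleN1r opprK /z addrC subrK.
Qed.

(** Deflation: an orthogonal change of basis taking the first basis vector to a unit eigenvector
    splits off a 1 x 1 block, and induction diagonalizes the rest. *)
Lemma symmetric_spectral n (A : 'M[R]_n) : A^T = A ->
  exists (v : 'M[R]_n) (d : 'rV[R]_n),
    v^T *m v = 1%:M /\ A = v *m diag_mx d *m v^T.
Proof.
elim: n A => [|n IH] A symA.
  by exists 1%:M, 0; split; apply/matrixP => -[].
have [a [w wA w0]] := symmetric_eigenvector symA.
wlog w1 : w wA w0 / w *m w^T = 1%:M.
  have nw : 0 < (w *m w^T) 0 0.
    have [i wi] : exists i, w 0 i != 0.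
      apply/existsP; apply: contraNT w0; rewrite negb_exists => /forallP h.
      by apply/eqP/rowP => i; rewrite mxE; apply/eqP; rewrite -[_ == _]negbK.
    rewrite mxE; under eq_bigr do rewrite [w^T _ _]mxE -expr2.
    rewrite (bigD1 i)//= ltr_pwDl//; first by rewrite lt0r sqrf_eq0 wi sqr_ge0.
    by rewrite sumr_ge0// => j _; rewrite sqr_ge0.
  move/(_ ((Num.sqrt ((w *m w^T) 0 0))^-1 *: w)); apply.
  - by rewrite -scalemxAl wA !scalerA mulrC.
  - by rewrite scaler_eq0 negb_or w0 andbT invr_eq0 gt_eqF// sqrtr_gt0.
  - rewrite linearZ /= -scalemxAl -scalemxAr scalerA -invfM -expr2.
    rewrite sqr_sqrtr ?ltW//; rewrite {2}[w *m _]mx11_scalar scale_scalar_mx.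
    by rewrite mulVf// gt_eqF.
have [H [HH eH]] := unit_row_householder w1.
have HH' := mulmx1C HH.
pose B : 'M[R]_(1 + n) := H *m A *m H^T.
have symB : B^T = B by rewrite /B !trmx_mul trmxK symA mulmxA.
have rowB : delta_mx 0 0 *m B = a *: delta_mx 0 0 :> 'rV_(1 + n).
  by rewrite /B !mulmxA eH wA -scalemxAl -eH -mulmxA HH' mulmx1.
have eA : A = H^T *m B *m H.
  by rewrite /B !mulmxA HH mul1mx -mulmxA HH mulmx1.
clearbody B.
(* The first row is [a] times the first basis vector; symmetry then clears the first column. *)
have eB : B = block_mx a%:M 0 0 (drsubmx B).
  have ur i : B 0 i = a *+ (i == 0).
    have /rowP/(_ i) := rowB; rewrite -rowE !mxE eqxx /= => ->.
    by case: (i == 0); rewrite ?mulr1 ?mulr0.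
  have l0 : lshift n 0 = 0 :> 'I_(1 + n) by apply/val_inj.
  rewrite -[LHS]submxK; congr block_mx.
  - by apply/matrixP => i j; rewrite !ord1 2!mxE l0 ur [RHS]mxE.
  - by apply/matrixP => i j; rewrite !ord1 2!mxE l0 ur [RHS]mxE.
  - by apply/matrixP => i j; rewrite !ord1 -symB 3!mxE l0 ur [RHS]mxE.
have [|v [d [vv eD]]] := IH (drsubmx B).
  by rewrite -[in RHS]symB trmx_drsub.
pose V : 'M[R]_(1 + n) := block_mx 1%:M 0 0 v.
have VV : V^T *m V = 1%:M.
  rewrite /V tr_block_mx mulmx_block !trmx0 !mulmx0 !mul0mx !addr0 add0r.
  by rewrite trmx1 mulmx1 vv -scalar_mx_block.
exists (H^T *m V), (row_mx a%:M d : 'rV_(1 + n)); split.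
  by rewrite trmx_mul trmxK mulmxA -[V^T *m _ *m _]mulmxA HH' mulmx1.
rewrite eA trmx_mul trmxK !mulmxA; congr (_ *m _).
rewrite -!mulmxA; congr (_ *m _).
suff : B = V *m (block_mx (diag_mx a%:M) 0 0 (diag_mx d) *m V^T).
  by rewrite -diag_mx_row.
rewrite eB {1}eD /V tr_block_mx !mulmx_block.
rewrite !trmx0 !mulmx0 !mul0mx !addr0 !add0r trmx1 mulmx1 mul1mx mulmxA.
congr block_mx; rewrite ?mulmx0 ?mul0mx ?addr0 ?add0r//.
by apply/matrixP => i j; rewrite !ord1 !mxE eqxx.
Qed.

End Spectral.

(** * Singular values *)

Section FiniteExtrema.
Context {R : realType}.

Lemma sup_finite (I : finType) (i0 : I) (f : I -> R) :
  exists2 i, sup [set s | exists j, s = f j] = f i & forall j, f j <= f i.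
Proof.
have [i _ fi] := arg_maxP f (isT : xpredT i0); exists i => [|j]; last exact: fi.
apply/le_anti/andP; split.
  by apply: ge_sup => [|_ [j ->]]; [exists (f i0), i0|exact: fi].
by apply: ub_le_sup; [exists (f i) => _ [j ->]; exact: fi|exists i].
Qed.

Lemma inf_finite (I : finType) (i0 : I) (f : I -> R) :
  exists2 i, inf [set s | exists j, s = f j] = f i & forall j, f i <= f j.
Proof.
have [i _ fi] := arg_minP f (isT : xpredT i0); exists i => [|j]; last exact: fi.
apply/le_anti/andP; split.
  by apply: ge_inf; [exists (f i) => _ [j ->]; exact: fi|exists i].
by apply: lb_le_inf => [|_ [j ->]]; [exists (f i0), i0|exact: fi].
Qed.

Lemma min_upto_le K (x : nat -> R) k : (k <= K)%N -> min_upto K x <= x k.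
Proof. by move=> kK; exact: (bigmin_le _ (Ordinal (kK : (k < K.+1)%N))). Qed.

Lemma lt_min_upto K (x : nat -> R) c :
  (forall k, (k <= K)%N -> c < x k) -> c < min_upto K x.
Proof. by move=> h; apply: lt_bigmin => [|[k ?] _]; exact: h. Qed.

Lemma max_upto_le K (x : nat -> R) c :
  (forall k, (k <= K)%N -> x k <= c) -> max_upto K x <= c.
Proof. by move=> h; apply: bigmax_le => [|[k ?] _]; exact: h. Qed.

Lemma le_max_upto K (x : nat -> R) k : (k <= K)%N -> x k <= max_upto K x.
Proof. by move=> kK; exact: (le_bigmax _ _ (Ordinal (kK : (k < K.+1)%N))). Qed.

End FiniteExtrema.

Section SingularValues.
Context {R : realType}.

(** Multiplying a row eigenvector by [v] gives one of [diag_mx d], and any nonzero coordinate of it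
    identifies the eigenvalue. *)
Lemma eigenvalue_orthogonal_diag n (v : 'M[R]_n) (d : 'rV[R]_n) a :
  v^T *m v = 1%:M ->
  eigenvalue (v *m diag_mx d *m v^T) a <-> exists i, a = d 0 i.
Proof.
move=> vv; split => [/eigenvalueP[w wa w0]|[i ->]].
  have /rV0Pn[i zi] : w *m v != 0.
    apply: contra_neq w0 => wv0.
    by rewrite -[w]mulmx1 -(mulmx1C vv) mulmxA wv0 mul0mx.
  exists i; apply: (mulIf zi); move/(congr1 (mulmx^~ v)): wa.
  rewrite -!mulmxA vv mulmx1 !mulmxA -scalemxAl mul_mx_diag => /rowP/(_ i).
  by rewrite [LHS]mxE [RHS]mxE => <-; rewrite mulrC.
apply/eigenvalueP; exists (delta_mx 0 i *m v^T).
  rewrite -mulmxA !mulmxA -[_ *m v^T *m v]mulmxA vv mulmx1 scalemxAl.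
  by congr (_ *m _); rewrite -rowE row_diag_mx.
apply/eqP => /(congr1 (mulmx^~ v)); rewrite -mulmxA vv mulmx1 mul0mx.
by move/rowP/(_ i)/eqP; rewrite !mxE !eqxx oner_eq0.
Qed.

Lemma orthogonal_diagM m n p (u : 'M[R]_(m, n)) (v : 'M[R]_n)
    (w : 'M[R]_(p, n)) (d e : 'rV[R]_n) : v^T *m v = 1%:M ->
  (u *m diag_mx d *m v^T) *m (v *m diag_mx e *m w^T) =
  u *m diag_mx (\row_i (d 0 i * e 0 i)) *m w^T.
Proof.
move=> vv; rewrite !mulmxA -[_ *m v^T *m v]mulmxA vv mulmx1.
by rewrite -[u *m _ *m _]mulmxA mulmx_diag.
Qed.

Lemma trmx_svd m n (u : 'M[R]_(m, n)) (v : 'M[R]_n) (d : 'rV[R]_n) :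
  (u *m diag_mx d *m v^T)^T = v *m diag_mx d *m u^T.
Proof. by rewrite !trmx_mul trmxK tr_diag_mx mulmxA. Qed.

Lemma gram_svd m n (u : 'M[R]_(m, n)) (v : 'M[R]_n) (d e : 'rV[R]_n) :
  u^T *m u = 1%:M ->
  (u *m diag_mx d *m v^T)^T *m (u *m diag_mx e *m v^T) =
  v *m diag_mx (\row_i (d 0 i * e 0 i)) *m v^T.
Proof.
move=> uu; rewrite trmx_svd !mulmxA -[_ *m u^T *m u]mulmxA uu mulmx1.
by rewrite -[v *m _ *m _]mulmxA mulmx_diag.
Qed.

Lemma frob_inner_svd m n (u : 'M[R]_(m, n)) (v : 'M[R]_n) (d e : 'rV[R]_n) :
  u^T *m u = 1%:M -> v^T *m v = 1%:M ->
  frob_inner (u *m diag_mx d *m v^T) (u *m diag_mx e *m v^T) =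
  \sum_i d 0 i * e 0 i.
Proof.
move=> uu vv; rewrite /frob_inner gram_svd// mxtrace_mulC mulmxA vv mul1mx.
by rewrite mxtrace_diag; apply: eq_bigr => i _; rewrite mxE.
Qed.

Section SVD.
Context {m n : nat} (u : 'M[R]_(m, n)) (v : 'M[R]_n).
Hypotheses (uu : u^T *m u = 1%:M) (vv : v^T *m v = 1%:M).

(** The entries of [d] may have any sign, so the result also covers differences such as [V - U] and
    [V^T V - 1]. *)
Lemma singular_value_svd (d : 'rV[R]_n) :
  singular_value (u *m diag_mx d *m v^T) =
  [set s | exists i, s = `|d 0 i|].
Proof.
rewrite predeqE => s; rewrite /singular_value gram_svd//; split=> /=.
  move=> [s0 e]; have [j] := proj1 (eigenvalue_orthogonal_diag _ _ vv) e.
  rewrite mxE => si.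
  exists j; apply/eqP; rewrite -(eqrXn2 (ltn0Sn 1)) ?normr_ge0//.
  by rewrite -normrX si -expr2 ger0_norm ?sqr_ge0.
move=> [i ->]; split=> //; apply/eigenvalue_orthogonal_diag => //; exists i.
by rewrite mxE -normrX ger0_norm ?sqr_ge0.
Qed.

Lemma spectral_norm_svd (d : 'rV[R]_n) : (0 < n)%N ->
  exists2 i, spectral_norm (u *m diag_mx d *m v^T) = `|d 0 i| &
    forall j, `|d 0 j| <= `|d 0 i|.
Proof.
move=> n0; rewrite /spectral_norm.
rewrite (_ : [set s | _] = [set s | exists i, s = `|d 0 i|]).
  exact: (sup_finite (Ordinal n0)).
exact: singular_value_svd.
Qed.

Lemma sigma_min_svd (d : 'rV[R]_n) : (0 < n)%N ->
  exists2 i, sigma_min (u *m diag_mx d *m v^T) = `|d 0 i| &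
    forall j, `|d 0 i| <= `|d 0 j|.
Proof.
move=> n0; rewrite /sigma_min.
rewrite (_ : [set s | _] = [set s | exists i, s = `|d 0 i|]).
  exact: (inf_finite (Ordinal n0)).
exact: singular_value_svd.
Qed.

Lemma orthogonal_diagD p (w : 'M[R]_(p, n)) (d e : 'rV[R]_n) :
  w *m diag_mx d *m v^T + w *m diag_mx e *m v^T = w *m diag_mx (d + e) *m v^T.
Proof. by rewrite raddfD mulmxDr mulmxDl. Qed.

Lemma orthogonal_diagZ p (w : 'M[R]_(p, n)) a (d : 'rV[R]_n) :
  a *: (w *m diag_mx d *m v^T) = w *m diag_mx (a *: d) *m v^T.
Proof. by rewrite scalemxAl scalemxAr -linearZ. Qed.

Lemma orthogonal_diag_const a : v *m diag_mx (const_mx a) *m v^T = a%:M.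
Proof.
by rewrite diag_const_mx mul_mx_scalar -scalemxAl (mulmx1C vv) scalemx1.
Qed.

Lemma dwh_step_svd a b c (d : 'rV[R]_n) :
  (forall i, 1 + c * d 0 i ^+ 2 != 0) ->
  dwh_step a b c (u *m diag_mx d *m v^T) =
  u *m diag_mx (\row_i (d 0 i * (a + b * d 0 i ^+ 2) / (1 + c * d 0 i ^+ 2)))
    *m v^T.
Proof.
move=> hc; rewrite /dwh_step gram_svd//.
rewrite -!orthogonal_diag_const !orthogonal_diagZ !orthogonal_diagD.
set den := const_mx 1 + _.
(* A one-sided inverse of a square matrix determines [invmx]; here it is read off entrywise in the
   basis [v]. *)
have -> : invmx (v *m diag_mx den *m v^T) =
    v *m diag_mx (\row_i (1 + c * d 0 i ^+ 2)^-1) *m v^T.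
  have e1 : (v *m diag_mx den *m v^T) *m
      (v *m diag_mx (\row_i (1 + c * d 0 i ^+ 2)^-1) *m v^T) = 1%:M.
    rewrite orthogonal_diagM// -[RHS]orthogonal_diag_const.
    by congr (_ *m diag_mx _ *m _); apply/rowP => i; rewrite !mxE -expr2 mulfV.
  have [ud _] := mulmx1_unit e1.
  by rewrite -[LHS]mulmx1 -e1 mulKmx.
rewrite !orthogonal_diagM//; congr (_ *m diag_mx _ *m _).
by apply/rowP => i; rewrite !mxE -!expr2.
Qed.

End SVD.

Lemma dwh_svd m n (u : 'M[R]_(m, n)) (v : 'M[R]_n) (d : 'rV[R]_n) G l0 T :
  u^T *m u = 1%:M -> v^T *m v = 1%:M -> 0 < l0 <= 1 ->
  dwh_init G = u *m diag_mx d *m v^T ->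
  dwh l0 G T = u *m diag_mx (\row_i qdwh_sv l0 (d 0 i) T) *m v^T.
Proof.
move=> uu vv hl0 G0; elim: T => [|j IH] /=.
  by rewrite G0; congr (_ *m diag_mx _ *m _); apply/rowP => i; rewrite mxE.
have hl := qdwh_ell_bounds j hl0.
rewrite IH dwh_step_svd// => [|i]; last by rewrite lt0r_neq0// qdwh_den_gt0.
by congr (_ *m diag_mx _ *m _); apply/rowP => i; rewrite !mxE.
Qed.

(** [A] factors through the [r] columns of [u]; conversely the invertible [diag_mx s] equals
    [u^T A v]. *)
Lemma compact_svd_rank m n r (A : 'M[R]_(m, n)) u (s : 'rV[R]_r) v :
  compact_svd A u s v -> \rank A = r.
Proof.
move=> [uu vv s0 ->]; apply/eqP; rewrite eqn_leq; apply/andP; split.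
  rewrite -mulmxA (leq_trans (mxrankM_maxl _ _))// rank_leq_col//.
have /mxrank_unit {1}<- : diag_mx s \in unitmx.
  rewrite unitmxE det_diag unitfE; apply/prodf_neq0 => i _.
  by rewrite gt_eqF.
have {1}-> : diag_mx s = u^T *m (u *m diag_mx s *m v^T) *m v.
  by rewrite !mulmxA uu mul1mx -mulmxA vv mulmx1.
by rewrite (leq_trans (mxrankM_maxl _ _))// mxrankM_maxr.
Qed.

(** Diagonalize [A^T A] as [v diag(d) v^T], then put [s = sqrt d] and [u = A v diag(1 / s)]. *)
Lemma full_rank_svd m n (A : 'M[R]_(m, n)) : \rank A = n ->
  exists (u : 'M[R]_(m, n)) s (v : 'M[R]_n), compact_svd A u s v.
Proof.
move=> rA; have [|v [d [vv eA]]] := @symmetric_spectral R n (A^T *m A).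
  by rewrite trmx_mul trmxK.
have eD : (A *m v)^T *m (A *m v) = diag_mx d.
  rewrite trmx_mul mulmxA -[v^T *m _ *m _]mulmxA eA !mulmxA vv mul1mx.
  by rewrite -mulmxA vv mulmx1.
have d_gt0 i : 0 < d 0 i.
  have -> : d 0 i = \sum_j (A *m v) j i ^+ 2.
    have /matrixP/(_ i i) := eD; rewrite !mxE eqxx mulr1n => <-.
    by apply: eq_bigr => j _; rewrite [X in X * _ = _]mxE expr2.
  rewrite lt0r sumr_ge0 ?andbT => [|j _]; last exact: sqr_ge0.
  apply/negP; rewrite psumr_eq0 => [/allP h|j _]; last exact: sqr_ge0.
  have c0 : col i (A *m v) = 0.
    apply/colP => j; rewrite mxE [RHS]mxE.
    by apply/eqP; rewrite -sqrf_eq0 (implyP (h j (mem_index_enum _))).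
  (* A zero eigenvalue would make a column of [A v] vanish, contradicting full column rank. *)
  have : row_free (A *m v)^T.
    rewrite -row_leq_rank mxrank_tr mxrankMfree ?rA//.
    by rewrite row_free_unit; case/mulmx1_unit: vv.
  move=> rf; have := @row_free_inj _ 1 _ _ _ rf (delta_mx 0 i) 0.
  rewrite mul0mx -rowE -tr_col c0 trmx0 => /(_ erefl)/rowP/(_ i)/eqP.
  by rewrite !mxE !eqxx oner_eq0.
pose s := \row_i Num.sqrt (d 0 i).
have s_gt0 i : 0 < s 0 i by rewrite mxE sqrtr_gt0.
exists (A *m v *m diag_mx (\row_i (s 0 i)^-1)), s, v; split=> //.
  rewrite trmx_mul tr_diag_mx mulmxA -[diag_mx _ *m _ *m _]mulmxA eD.
  rewrite !mulmx_diag.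
  rewrite -diag_const_mx; congr diag_mx; apply/rowP => i.
  rewrite !mxE -{2}(sqr_sqrtr (ltW (d_gt0 i))).
  by field; rewrite gt_eqF// sqrtr_gt0.
rewrite -[_ *m diag_mx s]mulmxA mulmx_diag -!mulmxA.
rewrite (_ : diag_mx _ = 1%:M); first by rewrite mul1mx (mulmx1C vv) mulmx1.
rewrite -diag_const_mx; congr diag_mx; apply/rowP => i.
by rewrite !mxE mulVf// gt_eqF// sqrtr_gt0.
Qed.

Lemma dwh_init_svd m n (A : 'M[R]_(m, n)) u (s : 'rV[R]_n) v :
  (0 < n)%N -> compact_svd A u s v ->
  exists x : 'rV[R]_n, [/\ dwh_init A = u *m diag_mx x *m v^T,
    (exists i, sigma_min (dwh_init A) = x 0 i),
    (forall i, sigma_min (dwh_init A) <= x 0 i) &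
    (forall i, 0 < x 0 i <= 1)].
Proof.
move=> n0 [uu vv s0 eA].
(* [s 0 i] is the largest singular value, so the normalized ones are [s 0 j / s 0 i]. *)
have [i eM hM] := spectral_norm_svd uu vv s n0.
have M0 : 0 < s 0 i := s0 i.
have x01 j : 0 < s 0 j / s 0 i <= 1.
  rewrite divr_gt0//= ler_pdivrMr// mul1r.
  by have := hM j; rewrite !gtr0_norm.
have e : dwh_init A = u *m diag_mx (\row_j (s 0 j / s 0 i)) *m v^T.
  rewrite /dwh_init eA eM gtr0_norm// orthogonal_diagZ.
  by congr (_ *m diag_mx _ *m _); apply/rowP => j; rewrite !mxE mulrC.
exists (\row_j (s 0 j / s 0 i)).
have [k ek hk] := sigma_min_svd uu vv (\row_j (s 0 j / s 0 i)) n0.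
split => //.
- by exists k; rewrite e ek mxE gtr0_norm//; case/andP: (x01 k).
- move=> j; rewrite e ek; apply: (le_trans (hk j)).
  by rewrite mxE gtr0_norm//; case/andP: (x01 j).
- by move=> j; rewrite mxE.
Qed.

End SingularValues.

(** * Convergence of DWH and of PolarGrad *)

Section DwhErrors.
Context {R : realType}.

Lemma sigma_min_dwh_init_bounds m n (A : 'M[R]_(m, n)) :
  (0 < n)%N -> \rank A = n -> 0 < sigma_min (dwh_init A) <= 1.
Proof.
move=> n0 /full_rank_svd[u [s [v usv]]].
by have [x [_ [i ->] _ x01]] := dwh_init_svd n0 usv.
Qed.

Lemma ell_min_bounds m n K (G : nat -> 'M[R]_(m, n)) : (0 < n)%N ->
  (forall k, (k <= K)%N -> \rank (G k) = n) -> 0 < ell_min K G <= 1.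
Proof.
move=> n0 rG; apply/andP; split.
  apply: lt_min_upto => k kK.
  by have /andP[] := sigma_min_dwh_init_bounds n0 (rG k kK).
apply: (le_trans (min_upto_le _ (leq0n K))).
by have /andP[] := sigma_min_dwh_init_bounds n0 (rG 0%N (leq0n K)).
Qed.

(** The factors [u] and [v] of [A] are kept, so that [dwh] can be compared entrywise with [A] and
    its polar factor. Only a lower bound [l0] is asked for, so one [l0] serves all iterations
    [k]. *)
Lemma dwh_singular_values m n (A : 'M[R]_(m, n)) u (s : 'rV[R]_n) v l0 T :
  (0 < n)%N -> compact_svd A u s v -> 0 < l0 <= sigma_min (dwh_init A) ->
  exists y : 'rV[R]_n, dwh l0 A T = u *m diag_mx y *m v^T /\
    forall i, 0 < y 0 i <= 1 /\ 1 - y 0 i ^+ 2 <= (1 - l0 ^+ 2) ^+ (3 ^ T)%N.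
Proof.
move=> n0 usv /andP[l0_gt0 l0s].
have [x [ex _ sx x01]] := dwh_init_svd n0 usv; have [uu vv _ _] := usv.
have l0x i : l0 <= x 0 i <= 1.
  by rewrite (le_trans l0s)//; case/andP: (x01 i).
have hl0 : 0 < l0 <= 1.
  by rewrite l0_gt0; have /andP[h1 h2] := l0x (Ordinal n0); exact: le_trans h2.
exists (\row_i qdwh_sv l0 (x 0 i) T); split; first exact: dwh_svd.
move=> i; rewrite mxE.
have /andP[y1 y2] := qdwh_sv_bounds T hl0 (l0x i).
have /andP[l1 l2] := qdwh_ell_bounds T hl0.
have y0 := lt_le_trans l1 y1; rewrite y0 y2; split=> //.
apply: le_trans (qdwh_ell_cvg T hl0).
by rewrite lerD2l lerN2 lerXn2r// nnegrE ltW.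
Qed.

(** The eigenvalues of the difference are the [y_i^2 - 1], none of them positive. *)
Lemma dwh_gram_error m n (A : 'M[R]_(m, n)) l0 T :
  (0 < n)%N -> \rank A = n -> 0 < l0 <= sigma_min (dwh_init A) ->
  0 <= spectral_norm ((dwh l0 A T)^T *m dwh l0 A T - 1%:M)
    <= (1 - l0 ^+ 2) ^+ (3 ^ T)%N.
Proof.
move=> n0 /full_rank_svd[u [s [v usv]]] l0s; have [uu vv _ _] := usv.
have [y [-> hy]] := dwh_singular_values T n0 usv l0s.
have -> : (u *m diag_mx y *m v^T)^T *m (u *m diag_mx y *m v^T) - 1%:M =
    v *m diag_mx (\row_i (y 0 i ^+ 2 - 1)) *m v^T.
  rewrite gram_svd// -scaleN1r -(orthogonal_diag_const vv) orthogonal_diagZ.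
  rewrite orthogonal_diagD; congr (_ *m diag_mx _ *m _); apply/rowP => i.
  by rewrite !mxE mulN1r expr2.
have [i -> _] := spectral_norm_svd vv vv (\row_i (y 0 i ^+ 2 - 1)) n0.
rewrite normr_ge0 mxE distrC; have [/andP[y0 y1] yE] := hy i.
by rewrite ger0_norm// subr_ge0 expr_le1// ltW.
Qed.

Lemma dwh_polar_error m n (A U : 'M[R]_(m, n)) l0 T :
  (0 < n)%N -> \rank A = n -> polar_factor A U ->
  0 < l0 <= sigma_min (dwh_init A) ->
  spectral_norm (dwh l0 A T - U) <= (1 - l0 ^+ 2) ^+ (3 ^ T)%N.
Proof.
move=> n0 rA [r [u [s [v [usv ->]]]]] l0s.
(* The polar factor comes with an arbitrary compact decomposition; its size must be the rank [n], so
   the iteration can be expanded in the same [u] and [v]. *)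
move: (compact_svd_rank usv); rewrite rA => rn; subst r.
have [uu vv _ _] := usv.
have [y [-> hy]] := dwh_singular_values T n0 usv l0s.
have -> : u *m diag_mx y *m v^T - u *m v^T =
    u *m diag_mx (\row_i (y 0 i - 1)) *m v^T.
  rewrite -scaleN1r -{2}[u]mulmx1 -diag_const_mx.
  rewrite orthogonal_diagZ orthogonal_diagD.
  by congr (_ *m diag_mx _ *m _); apply/rowP => i; rewrite !mxE mulN1r.
have [i -> _] := spectral_norm_svd uu vv (\row_i (y 0 i - 1)) n0.
rewrite mxE distrC; have [/andP[y0 y1] yE] := hy i.
(* For [0 < y <= 1] one has [1 - y <= 1 - y^2]. *)
rewrite ger0_norm ?subr_ge0//; apply: le_trans yE.
by rewrite lerD2l lerN2 expr2 ler_piMr// ltW.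
Qed.

End DwhErrors.

(** * The Frobenius inner product *)

Section FrobeniusInner.
Context {R : realType} {m n : nat}.
Implicit Types A B D : 'M[R]_(m, n).

Lemma frob_innerE A B : frob_inner A B = \sum_i \sum_j A i j * B i j.
Proof.
rewrite /frob_inner /mxtrace exchange_big; apply: eq_bigr => j _.
by rewrite mxE; apply: eq_bigr => i _; rewrite mxE.
Qed.

Lemma frob_innerC A B : frob_inner A B = frob_inner B A.
Proof.
rewrite !frob_innerE; apply: eq_bigr => i _; apply: eq_bigr => j _.
exact: mulrC.
Qed.

Lemma frob_innerDr A B D :
  frob_inner A (B + D) = frob_inner A B + frob_inner A D.
Proof. by rewrite /frob_inner mulmxDr mxtraceD. Qed.

Lemma frob_innerZr a A B : frob_inner A (a *: B) = a * frob_inner A B.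
Proof. by rewrite /frob_inner -scalemxAr mxtraceZ. Qed.

Lemma frob_innerBr A B D :
  frob_inner A (B - D) = frob_inner A B - frob_inner A D.
Proof. by rewrite frob_innerDr -scaleN1r frob_innerZr mulN1r. Qed.

Lemma frob_innerBl A B D :
  frob_inner (A - B) D = frob_inner A D - frob_inner B D.
Proof.
by rewrite frob_innerC frob_innerBr (frob_innerC D A) (frob_innerC D B).
Qed.

Lemma frob_inner_ge0 A : 0 <= frob_inner A A.
Proof.
rewrite frob_innerE; apply: sumr_ge0 => i _; apply: sumr_ge0 => j _.
by rewrite -expr2 sqr_ge0.
Qed.

Lemma frob_norm_sqr A : frob_norm A ^+ 2 = frob_inner A A.
Proof. by rewrite sqr_sqrtr// frob_inner_ge0. Qed.

(** Expansion of [|A - c D|^2 >= 0]; it takes the place of the Cauchy-Schwarz inequality below. *)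
Lemma frob_inner_young A D c :
  2 * c * frob_inner A D <= frob_inner A A + c ^+ 2 * frob_inner D D.
Proof.
have := frob_inner_ge0 (A - c *: D).
rewrite frob_innerBr frob_innerZr !frob_innerBl (frob_innerC (c *: D) A).
rewrite (frob_innerC (c *: D) D) !frob_innerZr.
lra.
Qed.

End FrobeniusInner.

Lemma is_derive_quadratic {R : realType} (a b t : R) :
  is_derive t 1 (a *: id + b *: id ^+ 2 : R -> R) (a + b * 2 * t).
Proof.
have d1 := is_deriveZ a (is_derive_id t (1 : R)).
have d2 := is_deriveZ b (is_deriveX 2 (is_derive_id t (1 : R))).
apply: (is_derive_eq (is_deriveD d1 d2)).
by rewrite /GRing.scale /= expr1; ring.
Qed.

(** * The descent lemma for smooth functions *)

Section Descent.
Context {R : realType} {m n : nat}.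
Variables (f : 'M[R]_(m, n) -> \bar R) (L : R).
Hypotheses (L0 : 0 < L) (fL : lipschitz_smooth f L).
Let F := fine \o f.

Lemma gradient_inner X D : 'd F X D = frob_inner (gradient f X) D.
Proof.
rewrite frob_innerE {1}[D]matrix_sum_delta linear_sum; apply: eq_bigr => i _.
rewrite linear_sum; apply: eq_bigr => j _.
by rewrite linearZ mxE mulrC.
Qed.

(** The difference quotient along the line is that of the directional derivative of [F] at
    [X + t D]. *)
Lemma is_derive_line X D (t : R) :
  is_derive t 1 (fun t => F (X + t *: D))
    (frob_inner (gradient f (X + t *: D)) D).
Proof.
have [_ dF _] := fL.
have e : (fun h : R => h^-1 *: (((fun t => F (X + t *: D)) \o shift t) (h *: 1)
      - F (X + t *: D))) =
    (fun h => h^-1 *: ((F \o shift (X + t *: D)) (h *: D) - F (X + t *: D))).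
  apply/funext => h; congr (_ *: (F _ - _)).
  by rewrite /= /shift [h *: 1]mulr1 scalerDl addrCA.
have dv : derivable F (X + t *: D) D by exact/diff_derivable/dF.
split; first by rewrite /derivable e.
rewrite -gradient_inner -deriveE; last exact: dF.
by rewrite /derive e.
Qed.

Lemma gradient_line_le X D t : 0 < t ->
  frob_inner (gradient f (X + t *: D)) D - frob_inner (gradient f X) D
    <= L * t * frob_inner D D.
Proof.
move=> t0; have [_ _ lip] := fL.
have Lt0 : 0 < L * t by rewrite mulr_gt0.
pose A := gradient f (X + t *: D) - gradient f X.
suff : frob_inner A D <= L * t * frob_inner D D by rewrite frob_innerBl.
have hA : frob_inner A A <= (L * t) ^+ 2 * frob_inner D D.
  have := lip (X + t *: D) X; rewrite -/A addrAC subrr add0r => h.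
  rewrite -[leLHS]frob_norm_sqr.
  have -> : (L * t) ^+ 2 * frob_inner D D = (L * frob_norm (t *: D)) ^+ 2.
    rewrite !exprMn frob_norm_sqr frob_innerZr frob_innerC frob_innerZr.
    by rewrite expr2 !mulrA.
  by rewrite lerXn2r// nnegrE ?mulr_ge0 ?sqrtr_ge0// ltW.
(* Young's inequality with [c = L t] balances its two terms; the common factor [L t] is then divided
   out. *)
rewrite -(ler_pM2l Lt0) mulrA -expr2.
by have := frob_inner_young A D (L * t); lra.
Qed.

(** Subtracting the quadratic model along the segment leaves [psi] with nonpositive derivative for
    [t > 0], so the mean value theorem on [[0, 1]] gives [psi 1 <= psi 0]. *)
Lemma descent X D :
  F (X + D) <= F X + frob_inner (gradient f X) D + L / 2 * frob_inner D D.
Proof.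
pose c := frob_inner (gradient f X) D; pose q := frob_inner D D.
pose psi (t : R) := F (X + t *: D) - (t * c + L / 2 * q * t ^+ 2).
pose dpsi t := frob_inner (gradient f (X + t *: D)) D - (c + L / 2 * q * 2 * t).
have dP (t : R) : is_derive t 1 psi (dpsi t).
  apply: is_deriveB; first exact: is_derive_line.
  have -> : (fun t : R => t * c + L / 2 * q * t ^+ 2) =
      c *: id + (L / 2 * q) *: id ^+ 2.
    by apply/funext => x; rewrite [x * c]mulrC.
  exact: is_derive_quadratic.
have cont : {within `[0, 1], continuous psi}.
  by apply: derivable_within_continuous => t _; exact: ex_derive.
have psi1 : psi 1 = F (X + D) - (1 * c + L / 2 * q * 1 ^+ 2).
  by rewrite /psi scale1r.
have psi0 : psi 0 = F X - (0 * c + L / 2 * q * 0 ^+ 2).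
  by rewrite /psi scale0r addr0.
have [t t01] := MVT ltr01 (fun t _ => dP t) cont.
have /andP[t0 _] : 0 < t < 1 by rewrite in_itv in t01.
have mean_value_bound (a b g c' q' : R) : g - c' <= L * t * q' ->
    a - (1 * c' + L / 2 * q' * 1 ^+ 2) - (b - (0 * c' + L / 2 * q' * 0 ^+ 2)) =
    (g - (c' + L / 2 * q' * 2 * t)) * (1 - 0) ->
    a <= b + c' + L / 2 * q' by lra.
rewrite psi1 psi0; exact: mean_value_bound (gradient_line_le X D t0).
Qed.

End Descent.

(** * The number of inner steps and the decrease in one PolarGrad step *)

Section PolarGradStep.
Context {R : realType}.

Lemma sum_sqr_le (I : finType) (x : I -> R) : (forall i, 0 <= x i) ->
  \sum_i x i ^+ 2 <= (\sum_i x i) ^+ 2.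
Proof.
move=> x0; rewrite expr2 mulr_suml; apply: ler_sum => i _.
rewrite expr2 ler_wpM2l// (bigD1 i)//= lerDl.
by apply: sumr_ge0.
Qed.

(* The constant 2 / ln 3 turns the bound on [T] into x^2 <= 3^T with
   x = ln eta / ln rho >= 2, so that rho^(3^T) <= rho^(2 x) = eta^2. *)
Lemma cubic_steps_suffice (rho eta : R) T : 0 < rho < 1 ->
  0 < eta <= Num.min 2^-1 (rho ^+ 2) ->
  Num.ceil (2 / ln 3 * ln (ln eta / ln rho)) <= T%:Z ->
  rho ^+ (3 ^ T)%N <= eta / 2.
Proof.
move=> /andP[r0 r1]; rewrite le_min => /and3P[e0 e2 er].
have lr : ln rho < 0 by rewrite ln_lt0// r0.
have ln3 : 0 < ln 3 :> R by rewrite ln_gt0// ltr1n.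
have x2 : 2 <= ln eta / ln rho.
  by rewrite ler_ndivlMr// mulr_natl -lnXn// ler_ln ?posrE// exprn_gt0.
rewrite ceil_le_int => hT; set x := ln eta / ln rho in x2 hT.
have x0 : 0 < x by lra.
have x3 : x ^+ 2 <= 3 ^+ T.
  rewrite -ler_ln ?posrE ?exprn_gt0// !lnXn//.
  move: hT; rewrite mulrAC ler_pdivrMr// => hT.
  by rewrite -[leLHS]mulr_natl -[leRHS]mulr_natl.
have e : rho ^+ (3 ^ T)%N <= eta ^+ 2.
  rewrite -ler_ln ?posrE ?exprn_gt0// !lnXn//.
  rewrite -[leLHS]mulr_natl -[leRHS]mulr_natl.
  rewrite natrX.
  have -> : ln eta = x * ln rho by rewrite /x divfK// lt_eqF.
  (* Multiplication by the negative [ln rho] reverses the order, leaving [2 x <= x^2 <= 3^T]. *)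
  rewrite mulrA ler_wnM2r ?(ltW lr)//; apply: le_trans x3.
  by rewrite expr2 ler_wpM2r// ltW.
by apply: (le_trans e); rewrite expr2 ler_wpM2l// ltW.
Qed.

(** With [p = <V, G>] the descent lemma gives the change [- gamma p^2 + L gamma^2 p^2 |V|^2 / 2].
    Since [|V|^2 <= n], the step size makes [L gamma |V|^2 <= 1], so half of the linear gain
    survives. *)
Lemma polargrad_descent m n (f : 'M[R]_(m, n) -> \bar R) L X l0 T delta
    (V := dwh l0 (gradient f X) T) (gamma := 1 / (L * n%:R * (1 + delta))) :
  (0 < n)%N -> 0 < L -> lipschitz_smooth f L -> 0 <= delta ->
  \rank (gradient f X) = n ->
  0 < l0 <= sigma_min (dwh_init (gradient f X)) ->
  fine (f (X - (gamma * frob_inner V (gradient f X)) *: V)) <=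
  fine (f X) - gamma / 2 * (1 - (1 - l0 ^+ 2) ^+ (3 ^ T)%N) *
    frob_norm (gradient f X) ^+ 2.
Proof.
move=> n0 L0 fL d0 rG l0s.
have nR : 0 < n%:R :> R by rewrite ltr0n.
have [u [s [v usv]]] := full_rank_svd rG.
have [y [eV hy]] := dwh_singular_values T n0 usv l0s.
have [uu vv s0 eG] := usv.
rewrite frob_norm_sqr.
set p := frob_inner V _; set E := (1 - l0 ^+ 2) ^+ _ in hy *.
have VV : frob_inner V V <= n%:R * (1 + delta).
  rewrite /V eV frob_inner_svd//; apply: (@le_trans _ _ n%:R); last first.
    by rewrite ler_peMr ?(ltW nR)// lerDl.
  rewrite -[n in leRHS]card_ord -sum1_card natr_sum; apply: ler_sum => i _.
  by have [/andP[y0 y1] _] := hy i; rewrite -expr2 expr_le1// ltW.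
(* All [y_i s_i] are nonnegative, so the square of their sum dominates the sum of [y_i^2 s_i^2],
   where [y_i^2 >= 1 - E]. *)
have hp : (1 - E) * frob_inner (gradient f X) (gradient f X) <= p ^+ 2.
  rewrite /p /V eV eG !frob_inner_svd// mulr_sumr.
  have ys0 i : 0 <= y 0 i * s 0 i.
    by have [/andP[y0 y1] _] := hy i; rewrite mulr_ge0// ltW.
  apply: le_trans (sum_sqr_le ys0); apply: ler_sum => i _.
  rewrite -expr2 exprMn ler_wpM2r ?sqr_ge0//.
  by have [_] := hy i; lra.
have g0 : 0 < gamma by rewrite divr_gt0// !mulr_gt0// ltr_pwDl.
have gE : L * (n%:R * (1 + delta)) * gamma = 1.
  rewrite /gamma; field; rewrite !gt_eqF//.
  by rewrite ltr_pwDl.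
have := descent L0 fL X (- ((gamma * p) *: V)).
rewrite -scaleNr frob_innerZr (frob_innerC _ V) -/p frob_innerZr.
rewrite (frob_innerC _ V) frob_innerZr /=.
move: (fine (f X)) (fine (f (X + _))) => a b.
move: (frob_inner V V) (frob_inner (gradient f X) (gradient f X)) VV hp => q w.
move=> VV hp hb; apply: (le_trans hb).
have h1 : L * gamma * q <= 1.
  by rewrite -gE [leRHS]mulrAC ler_wpM2l// ltW// mulr_gt0.
have h2 : L * gamma * q * (gamma * p ^+ 2) <= gamma * p ^+ 2.
  by rewrite ler_piMl// mulr_ge0 ?sqr_ge0// ltW.
have h3 : gamma * ((1 - E) * w) <= gamma * p ^+ 2 by rewrite ler_pM2l.
nra.
Qed.

End PolarGradStep.

Theorem theorem3p9 (R : realType) (m n K : nat)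
    (hn : (1 <= n)%N) (hmn : (n <= m)%N) :
  (forall G U : nat -> 'M[R]_(m, n),
     (forall k, (k <= K)%N -> \rank (G k) = n) ->
     (forall k, (k <= K)%N -> polar_factor (G k) (U k)) ->
     let l0 := ell_min K G in
     0 < l0 <= 1 /\
     exists Ceps Cdelta : R,
       [/\ 0 < Ceps, 0 < Cdelta &
           forall T : nat,
             eps_max K l0 G U T <= Ceps * (1 - l0 ^+ 2) ^+ (3 ^ T)%N /\
             delta_max K l0 G T <= Cdelta * (1 - l0 ^+ 2) ^+ (3 ^ T)%N])
  /\
  (forall (f : 'M[R]_(m, n) -> \bar R) (L mu fstar : R),
     0 < L -> 0 < mu ->
     lipschitz_smooth f L ->
     is_minimum f fstar ->
     polyak_lojasiewicz f fstar mu ->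
     forall l0 : R, 0 < l0 < 1 ->
     exists C eta0 : R,
       [/\ 0 < C, 0 < eta0 < 1 &
           forall eta : R, 0 < eta <= eta0 ->
           forall T : nat,
             (Num.ceil (C * ln (ln eta / ln (1 - l0 ^+ 2))) <= T%:Z)%R ->
           forall X : nat -> 'M[R]_(m, n),
             let G := fun k : nat => gradient f (X k) in
             let V := fun k : nat => dwh l0 (G k) T in
             let rmax := (\max_(k < K.+1) \rank (G k))%N in
             let gamma := 1 / (L * rmax%:R * (1 + delta_max K l0 G T)) in
             let kappa := L / mu in
             (forall k, (k <= K)%N -> \rank (G k) = n) ->
             ell_min K G = l0 ->
             (forall k, (k <= K)%N ->
                X k.+1 = X k - (gamma * frob_inner (V k) (G k)) *: V k) ->
             forall k, (k <= K)%N ->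
               (f (X k.+1) - fstar%:E
                <= (1 - (1 - eta) / (rmax%:R * kappa))%:E
                   * (f (X k) - fstar%:E))%E]).
Proof.
have n0 : (0 < n)%N := hn.
split=> [G U rG pU l0|].
  have hl0 : 0 < l0 <= 1 := ell_min_bounds n0 rG.
  split=> //; exists 1, 1; split=> // T; rewrite !mul1r.
  have l0s k : (k <= K)%N -> 0 < l0 <= sigma_min (dwh_init (G k)).
    move=> kK; have /andP[-> _] := hl0.
    exact: (min_upto_le (fun k => sigma_min (dwh_init (G k))) kK).
  split; apply: max_upto_le => k kK.
    exact: (dwh_polar_error T n0 (rG k kK) (pU k kK) (l0s k kK)).
  by have /andP[] := dwh_gram_error T n0 (rG k kK) (l0s k kK).
move=> f L mu fstar L0 mu0 fL [_ fmin] fPL l0 /andP[l0_gt0 l0_lt1].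
have rho01 : 0 < 1 - l0 ^+ 2 < 1.
  by rewrite subr_gt0 gtrBl exprn_gt0// andbT expr_lt1// ltW.
have ln3 : 0 < ln 3 :> R by rewrite ln_gt0// ltr1n.
(* These are the constants of [cubic_steps_suffice] at [rho = 1 - l0^2]; the [2^-1] also keeps
   [eta0] below 1. *)
exists (2 / ln 3), (Num.min 2^-1 ((1 - l0 ^+ 2) ^+ 2)); split.
- by rewrite divr_gt0.
- have /andP[r0 r1] := rho01; rewrite lt_min gt_min invr_gt0 ltr0n exprn_gt0//=.
  by rewrite invf_lt1 ?ltr1n.
move=> eta heta T hT X G V rmax gamma kappa rG l0E Xstep k kK.
have ErhoT := cubic_steps_suffice rho01 heta hT.
have eta0 : 0 < eta by case/andP: heta.
have l0s j : (j <= K)%N -> 0 < l0 <= sigma_min (dwh_init (G j)).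
  by move=> jK; rewrite l0_gt0 -l0E min_upto_le.
have er : rmax = n.
  apply/eqP; rewrite eqn_leq; apply/andP; split.
    by apply/bigmax_leqP => -[j jK] _; rewrite rG.
  by rewrite -[leqLHS](rG k kK) (leq_bigmax (Ordinal (kK : (k < K.+1)%N))).
have delta_le : delta_max K l0 G T <= eta / 2.
  apply: le_trans ErhoT; apply: max_upto_le => j jK.
  by have /andP[] := dwh_gram_error T n0 (rG j jK) (l0s j jK).
have delta_ge0 : 0 <= delta_max K l0 G T.
  apply: le_trans (le_max_upto _ kK).
  by have /andP[] := dwh_gram_error T n0 (rG k kK) (l0s k kK).
have [ffin _ _] := fL.
have step : fine (f (X k.+1)) <= fine (f (X k)) -
    gamma / 2 * (1 - (1 - l0 ^+ 2) ^+ (3 ^ T)%N) * frob_norm (G k) ^+ 2.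
  rewrite (Xstep k kK) /gamma er.
  exact: (polargrad_descent T n0 L0 fL delta_ge0 (rG k kK) (l0s k kK)).
have := fPL (X k); have := fmin (X k).
rewrite -(fineK (ffin (X k))) -(fineK (ffin (X k.+1))) -!EFinB -!EFinM !lee_fin.
move=> fstar_le pl.
have nR : 0 < n%:R :> R by rewrite ltr0n.
have rate : (1 - eta) / (rmax%:R * kappa) <=
    gamma * mu * (1 - (1 - l0 ^+ 2) ^+ (3 ^ T)%N).
  have d1 : 0 < 1 + delta_max K l0 G T by rewrite ltr_pwDl.
  have -> : (1 - eta) / (rmax%:R * kappa) = mu / (L * n%:R) * (1 - eta).
    by rewrite er /kappa; field; rewrite !gt_eqF.
  have -> : gamma * mu * (1 - (1 - l0 ^+ 2) ^+ (3 ^ T)%N) =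
      mu / (L * n%:R) * ((1 - (1 - l0 ^+ 2) ^+ (3 ^ T)%N) /
        (1 + delta_max K l0 G T)).
    by rewrite /gamma er; field; rewrite !gt_eqF.
  rewrite ler_wpM2l ?divr_ge0 ?mulr_ge0 ?(ltW L0) ?(ltW mu0) ?(ltW nR)//.
  (* Both errors are at most [eta / 2], and [(1 - eta) (1 + eta / 2) <= 1 - eta / 2]. *)
  by rewrite ler_pdivlMr//; nra.
have gE0 : 0 <= gamma / 2 * (1 - (1 - l0 ^+ 2) ^+ (3 ^ T)%N).
  rewrite mulr_ge0 ?divr_ge0 ?mulr_ge0 ?ler0n ?(ltW L0)//.
    by rewrite addr_ge0.
  rewrite subr_ge0 exprn_ile1//; have /andP[r0 r1] := rho01; exact: ltW.
(* The PL inequality turns the guaranteed decrease into [gamma mu (1 - E)] times the optimality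
   gap. *)
have h1 := ler_wpM2l gE0 pl.
have h2 : (1 - eta) / (rmax%:R * kappa) * (fine (f (X k)) - fstar) <=
    gamma * mu * (1 - (1 - l0 ^+ 2) ^+ (3 ^ T)%N) * (fine (f (X k)) - fstar).
  by rewrite ler_wpM2r// subr_ge0.
rewrite mulrBl mul1r; lra.
Qed.
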